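(* Consider the partially quantized gossip algorithm with deterministic quantizer $q_d$: at each time $t$, when the edge $(i,j)$ is selected, $$x_i(t+1)= \tfrac12 x_i(t)+\tfrac12 q_d(x_j(t)),\qquad x_j(t+1)= \tfrac12 x_j(t)+\tfrac12 q_d(x_i(t)),$$ and $x_h(t+1)=x_h(t)$ for $h\ne i,j$, starting from a given $x(0)\in\mathbb{R}^N$. Then, almost surely, there exists $T_{\mathrm{con}}\in\mathbb{Z}_{\ge0}$ such that, for all $t\ge T_{\mathrm{con}}$, $$|x_i(t)-x_j(t)|\le1\quad\text{for all } i,j\in\{1,\dots,N\}$$ and $\|x(t)-x_{\mathrm{ave}}(0)\mathbf{1}\|_\infty\le2$.
   Context: Let $\mathcal{G}=(\mathcal{V},\mathcal{E})$ be an undirected connected graph with node set $\mathcal{V}=\{1,\dots,N\}$, whose edges join distinct nodes. At each time $t\in\mathbb{Z}_{\ge0}$ one edge $(i,j)\in\mathcal{E}$ is randomly selected, with probability $W^{(i,j)}>0$, where $\sum_{(i,j)\in\mathcal{E}}W^{(i,j)}=1$; selections at different times are independent. The state is $x(t)=[x_1(t),\dots,x_N(t)]^*\in\mathbb{R}^N$, $\mathbf{1}$ is the all-ones vector, and $x_{\mathrm{ave}}(t)=\frac1N\mathbf{1}^*x(t)$. The deterministic quantizer $q_d:\mathbb{R}\to\mathbb{Z}$ sends $z$ to its nearest integer, as follows: $q_d(z)=n\in\mathbb{Z}$ if and only if $z\in[n-1/2,n+1/2)$ when $z\ge0$, and $z\in(n-1/2,n+1/2]$ when $z<0$. *)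

(* Defs.v *)
From HB Require Import structures.
From mathcomp Require Import all_boot all_order all_algebra.
From mathcomp Require Import finmap.
From mathcomp Require Import all_classical all_reals all_analysis.
From mathcomp Require Import lra.

Set Implicit Arguments.
Unset Strict Implicit.
Unset Printing Implicit Defensive.

Import Order.TTheory GRing.Theory Num.Theory.
Import numFieldNormedType.Exports.

Local Open Scope classical_set_scope.
Local Open Scope ring_scope.

(* Nearest integer, ties rounded away from zero; qdP is the characterization by
   half-open intervals. *)
Definition qd (R : realType) (z : R) : int :=
  if 0 <= z then Num.floor (z + 2^-1) else Num.ceil (z - 2^-1).

Lemma qdP (R : realType) (z : R) (n : int) :
  qd z = n <->
  (if 0 <= z then z \in `[n%:~R - 2^-1, n%:~R + 2^-1[
   else z \in `]n%:~R - 2^-1, n%:~R + 2^-1]).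
Proof.
rewrite /qd; case: ifP => _; rewrite in_itv /=; split.
- by move/eqP; rewrite floor_eq intrD => /andP[? ?]; apply/andP; split; lra.
- by move=> /andP[? ?]; apply/eqP; rewrite floor_eq intrD; apply/andP; split; lra.
- by move/eqP; rewrite ceil_eq intrB => /andP[? ?]; apply/andP; split; lra.
- by move=> /andP[? ?]; apply/eqP; rewrite ceil_eq intrB; apply/andP; split; lra.
Qed.

(* An undirected edge {i, j} is represented by the ordered pair (i, j), i < j. *)
Definition edges (N : nat) (adj : rel 'I_N) : {set 'I_N * 'I_N} :=
  [set p : 'I_N * 'I_N | (p.1 < p.2)%N && adj p.1 p.2]%SET.

Definition gossip_step (R : realType) (N : nat) (p : 'I_N * 'I_N)
    (x : 'cV[R]_N) : 'cV[R]_N :=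
  \col_h (if h == p.1 then 2^-1 * x p.1 0 + 2^-1 * (qd (x p.2 0))%:~R
          else if h == p.2 then 2^-1 * x p.2 0 + 2^-1 * (qd (x p.1 0))%:~R
          else x h 0).

(* x(t), when edge s is selected at time s. *)
Fixpoint gossip_state (R : realType) (N : nat) (edge : nat -> 'I_N * 'I_N)
    (x0 : 'cV[R]_N) (t : nat) : 'cV[R]_N :=
  if t is t'.+1 then gossip_step (edge t') (gossip_state edge x0 t') else x0.

Definition average (R : realType) (N : nat) (x : 'cV[R]_N) : R :=
  N%:R^-1 * \sum_(i < N) x i 0.

(* Random variables with values in D, endowed with its discrete sigma-algebra. *)
Definition measurable_discrete_valued (d : measure_display) (T : measurableType d)
    (D : Type) (X : T -> D) : Prop :=
  forall A : set D, measurable (X @^-1` A).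

Definition independent_sequence (d : measure_display) (T : measurableType d)
    (R : realType) (P : probability T R) (D : Type) (X : nat -> T -> D) : Prop :=
  forall (J : {fset nat}) (A : nat -> set D),
    P (\bigcap_(t in [set` J]) (X t @^-1` A t)) =
    (\prod_(t <- J) P (X t @^-1` A t))%E.

(* Main.v *)
(* Let f_i = floor (2 x_i). Since q_d(z) + floor z <= floor (2 z), the sum of the
   f_i never increases; q_d being odd, the same holds for -x. As the sum of the
   2 x_i lies between the two corresponding bounds, both integer sums are bounded
   and eventually constant. Constancy forces equality above, i.e. no negative
   tie is rounded any more, and then f evolves autonomously by
   f_i' = floor (f_i / 2) + ceil (f_j / 2). In this finite-state system some word
   of edges leads every state of a given bounded box to values differing by at
   most 1, an absorbing property; almost surely this word is eventually played.
   The monotonicity of the two sums also pins the consensus value: the initial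
   average lies within 1 of every final state. *)
Require Import Defs.
From HB Require Import structures.
From mathcomp Require Import all_boot all_order all_algebra.
From mathcomp Require Import finmap.
From mathcomp Require Import all_classical all_reals all_analysis.
From mathcomp Require Import zify ring lra.

Set Implicit Arguments.
Unset Strict Implicit.
Unset Printing Implicit Defensive.

Import Order.TTheory GRing.Theory Num.Theory.
Import numFieldNormedType.Exports.

Local Open Scope classical_set_scope.
Local Open Scope ring_scope.

(** * The integer dynamics *)

(** The second term is the ceiling of b / 2. Floor and ceiling of a half add up to the whole, so
    [iavg a b + iavg b a = a + b]. *)
Definition iavg (a b : int) : int := (a %/ 2)%Z + ((b + 1) %/ 2)%Z.

Definition istep (N : nat) (p : 'I_N * 'I_N) (f : 'I_N -> int) : 'I_N -> int :=
  fun h => if h == p.1 then iavg (f p.1) (f p.2)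
           else if h == p.2 then iavg (f p.2) (f p.1) else f h.

Definition irun (N : nat) (f : 'I_N -> int) (w : seq ('I_N * 'I_N)) :
    'I_N -> int :=
  foldl (fun g p => istep p g) f w.

Definition near_consensus (N : nat) (f : 'I_N -> int) : Prop :=
  forall i j, f i - f j <= 1.

Definition energy (N : nat) (f : 'I_N -> int) : int := \sum_i f i ^+ 2.

Lemma iavg_bounds (l u a b : int) :
  l <= a <= u -> l <= b <= u -> l <= iavg a b <= u.
Proof. rewrite /iavg; lia. Qed.

Lemma istep_bounds (N : nat) (l u : int) (p : 'I_N * 'I_N) (f : 'I_N -> int) :
  (forall i, l <= f i <= u) -> forall i, l <= istep p f i <= u.
Proof.
move=> fP i; rewrite /istep; case: ifP => _; last case: ifP => _ //.
- exact: iavg_bounds.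
- exact: iavg_bounds.
Qed.

(** All values lie in some {m, m + 1}, and a step fixes or swaps the two values it involves. *)
Lemma near_consensus_istep (N : nat) (p : 'I_N * 'I_N) (f : 'I_N -> int) :
  near_consensus f -> near_consensus (istep p f).
Proof.
move=> fP i j; rewrite /istep /iavg.
have := fP i j; have := fP p.1 p.2; have := fP p.2 p.1; have := fP i p.1.
have := fP i p.2; have := fP p.1 j; have := fP p.2 j.
by do !case: ifP => _; lia.
Qed.

Lemma near_consensus_irun (N : nat) (w : seq ('I_N * 'I_N)) (f : 'I_N -> int) :
  near_consensus f -> near_consensus (irun f w).
Proof. by elim: w f => //= p w IH f fP; apply/IH/near_consensus_istep. Qed.

Lemma irun_cat (N : nat) (f : 'I_N -> int) w1 w2 :
  irun f (w1 ++ w2) = irun (irun f w1) w2.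
Proof. exact: foldl_cat. Qed.

(** As a + b is preserved, the sum of squares is governed by |a - b|: with a gap of at most 1 the
    pair is fixed or swapped, a larger gap strictly shrinks. *)
Lemma iavg_sqr_le (a b : int) :
  iavg a b ^+ 2 + iavg b a ^+ 2 <= a ^+ 2 + b ^+ 2 ?= iff (`|a - b| <= 1).
Proof.
have [h|h] := leP `|a - b| 1.
  have [[-> ->]|[-> ->]] : iavg a b = a /\ iavg b a = b \/ iavg a b = b /\ iavg b a = a.
  - by rewrite /iavg; lia.
  - by split; [exact: lexx | exact: eqxx].
  - by rewrite addrC; split; [exact: lexx | exact: eqxx].
have lt_diff : `|iavg a b - iavg b a| < `|a - b| by rewrite /iavg; lia.
rewrite -ltr_sqr ?nnegrE // !real_normK ?num_real // in lt_diff.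
suff lt : iavg a b ^+ 2 + iavg b a ^+ 2 < a ^+ 2 + b ^+ 2.
  by split; [exact: ltW | exact: lt_eqF].
have e : iavg b a = a + b - iavg a b by rewrite /iavg; lia.
by rewrite e in lt_diff *; clear -lt_diff; move: (iavg a b) lt_diff => c lt; nra.
Qed.

Lemma sum_pair (I : finType) (V : nmodType) (F : I -> V) (i j : I) : i != j ->
  \sum_h F h = F i + F j + \sum_(h | (h != i) && (h != j)) F h.
Proof.
by move=> ij; rewrite (bigD1 i) //= (bigD1 j) ?addrA //= eq_sym.
Qed.

Lemma energy_pair (N : nat) (i j : 'I_N) (f g : 'I_N -> int) :
  i != j -> g i = iavg (f i) (f j) -> g j = iavg (f j) (f i) ->
  (forall h, h != i -> h != j -> g h = f h) ->
  energy g <= energy f ?= iff (`|f i - f j| <= 1).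
Proof.
move=> ij gi gj gh; rewrite /energy !(sum_pair _ ij) gi gj.
rewrite (eq_bigr (fun h => f h ^+ 2)) => [|h /andP[hi hj]]; last by rewrite gh.
have [le eq] := iavg_sqr_le (f i) (f j).
by split; [rewrite lerD2r | rewrite (inj_eq (addIr _))].
Qed.

(** * Reaching near consensus along the edges of a connected graph *)

Section Graph.
Context (N : nat) (adj : rel 'I_N).
Hypotheses (adj_sym : symmetric adj) (adj_irr : irreflexive adj).

Lemma edge_istep (i j : 'I_N) : adj i j -> exists2 p, p \in edges adj &
  forall f, [/\ istep p f i = iavg (f i) (f j),
                istep p f j = iavg (f j) (f i) &
                forall h, h != i -> h != j -> istep p f h = f h].
Proof.
move=> aij; have ij : i != j by apply: contraTneq aij => ->; rewrite adj_irr.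
have ji : (j == i) = false by rewrite eq_sym (negbTE ij).
have [lt|gt|eq] := ltngtP i j; last by rewrite (val_inj eq) eqxx in ij.
- exists (i, j); first by rewrite inE /= lt aij.
  by rewrite /istep /=; split=> [||h /negbTE -> /negbTE ->] //; rewrite ?eqxx ?ji.
- exists (j, i); first by rewrite inE /= gt adj_sym aij.
  rewrite /istep /=; split=> [||h /negbTE -> /negbTE ->] //.
    by rewrite (negbTE ij) eqxx.
  by rewrite eqxx.
Qed.

(* If an edge near one end of the path does not already decrease the energy and
   no shorter path does, then the neighbours of both ends carry the same value k
   and the ends carry k + 1 and k - 1. The rule swaps 2m and 2m + 1 but fixes
   2m - 1 and 2m, so, depending on the parity of k, exactly one of the two ends
   can be moved towards the other. *)
Lemma energy_decrease_path (n : nat) (v : nat -> 'I_N) (f : 'I_N -> int) :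
  (forall k, (k < n)%N -> adj (v k) (v k.+1)) -> 1 < `|f (v 0) - f (v n)| ->
  exists2 w, {subset w <= edges adj} & energy (irun f w) < energy f.
Proof.
elim: n v f => [|n IH] v f adjv; first by rewrite subrr normr0.
move=> far.
have step i j : adj i j -> 1 < `|f i - f j| ->
    exists2 w, {subset w <= edges adj} & energy (irun f w) < energy f.
  move=> aij fij; have [p pE /(_ f)[pi pj ph]] := edge_istep aij.
  have ij : i != j by apply: contraTneq aij => ->; rewrite adj_irr.
  exists [:: p]; first by move=> q; rewrite inE => /eqP ->.
  by rewrite (lt_leif (energy_pair ij pi pj ph)) -ltNge.
(* If the edge at one end merely swaps its values, [v'] inherits the value of that end and the other
   end [u] is untouched. A word for the shorter path, prefixed by this edge, then serves, as the
   swap does not raise the energy. *)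
have swap i j u v' : adj i j -> u != i -> u != j -> v' = j ->
    iavg (f i) (f j) = f j -> iavg (f j) (f i) = f i ->
    (forall g : 'I_N -> int, g v' = f i -> g u = f u ->
      exists2 w, {subset w <= edges adj} & energy (irun g w) < energy g) ->
    exists2 w, {subset w <= edges adj} & energy (irun f w) < energy f.
  move=> aij ui uj -> ei ej gP; have [p pE /(_ f)[pi pj ph]] := edge_istep aij.
  have ij : i != j by apply: contraTneq aij => ->; rewrite adj_irr.
  have [|w wE lt] := gP (istep p f) _ (ph _ ui uj); first by rewrite pj ej.
  exists (p :: w); first by move=> q; rewrite inE => /predU1P[->|/wE].
  apply: lt_le_trans lt _; exact: (energy_pair ij pi pj ph).
have a0 := adjv 0 isT; have an := adjv n (ltnSn n).
have [h|d1] := ltP 1 `|f (v 0) - f (v 1)|; first exact: step h.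
have [h|d2] := ltP 1 `|f (v n) - f (v n.+1)|; first exact: step h.
have [h|d3] := ltP 1 `|f (v 1) - f (v n.+1)|.
  by apply: (IH (v \o succn)) => // k kn; apply: adjv.
have [h|d4] := ltP 1 `|f (v 0) - f (v n)|.
  by apply: (IH v) => // k kn; apply/adjv/ltnW.
(* The path may revisit nodes, so distinctness is read off from the values. *)
have neq i j : f i <> f j -> i != j by move=> fij; apply/eqP => ij; rewrite ij in fij.
have [sw|sw] : (iavg (f (v 0)) (f (v 1)) = f (v 1) /\
     iavg (f (v 1)) (f (v 0)) = f (v 0)) \/
    (iavg (f (v n.+1)) (f (v n)) = f (v n) /\
     iavg (f (v n)) (f (v n.+1)) = f (v n.+1)).
  by rewrite /iavg; clear -d1 d2 d3 d4 far; lia.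
- apply: (swap (v 0) (v 1) (v n.+1) (v 1)) => //.
  + by apply: neq; lia.
  + by apply: neq; lia.
  + by case: sw.
  + by case: sw.
  move=> g g1 gn; apply: (IH (v \o succn)) => [k kn|/=]; first exact: adjv.
  by rewrite g1 gn.
- apply: (swap (v n.+1) (v n) (v 0) (v n)) => //.
  + by rewrite adj_sym.
  + by apply: neq; lia.
  + by apply: neq; lia.
  + by case: sw.
  + by case: sw.
  move=> g gn g0; apply: (IH v) => [k kn|]; first exact/adjv/ltnW.
  by rewrite g0 gn.
Qed.

Hypothesis adj_connected : forall i j : 'I_N, connect adj i j.

(** Strong induction on the energy, a nonnegative integer: two nodes differing by more than 1 are
    joined by a path, along which it can be lowered. *)
Lemma near_consensus_reachable (f : 'I_N -> int) :
  exists2 w, {subset w <= edges adj} & near_consensus (irun f w).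
Proof.
have [n] := ubnP `|energy f|%N; elim: n f => // n IH f fn.
have [/forallP fP|] := boolP [forall i, [forall j, f i - f j <= 1]].
  by exists [::] => // i j; have /forallP := fP i; apply.
rewrite negb_forall => /existsP[i]; rewrite negb_forall => /existsP[j fij].
have /connectP[s sp js] := adj_connected i j.
have [||w1 w1E lt] := @energy_decrease_path (size s) (nth i (i :: s)) f.
- exact/(pathP i).
- rewrite -[size s]/(size (i :: s)).-1 nth_last /= -js.
  by move: fij; clear; lia.
have ge0 g : 0 <= energy g :> int by apply: sumr_ge0 => h _; apply: sqr_ge0.
have [|w2 w2E w2P] := IH (irun f w1).
  by have := ge0 _ f; have := ge0 _ (irun f w1); lia.
exists (w1 ++ w2); last by rewrite irun_cat.
by move=> p; rewrite mem_cat => /orP[/w1E|/w2E].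
Qed.

(* One word serves all states of a finite family: append, state after state, a
   word bringing the image of the next one to near consensus. *)
Lemma near_consensus_word (I : finType) (F : I -> 'I_N -> int) :
  exists2 w, {subset w <= edges adj} & forall i, near_consensus (irun (F i) w).
Proof.
suff [w wE wP] : exists2 w, {subset w <= edges adj} &
    {in enum I, forall i, near_consensus (irun (F i) w)}.
  by exists w => // i; apply: wP; rewrite mem_enum.
elim: (enum I) => [|i s [w1 w1E w1P]]; first by exists [::].
have [w2 w2E w2P] := near_consensus_reachable (irun (F i) w1).
exists (w1 ++ w2) => [p|j]; first by rewrite mem_cat => /orP[/w1E|/w2E].
rewrite irun_cat inE => /predU1P[->//|/w1P]; exact: near_consensus_irun.
Qed.

Lemma near_consensus_word_bounded (b : nat) :
  exists2 w, {subset w <= edges adj} &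
  forall f : 'I_N -> int, (forall i, `|f i| <= b%:Z) -> near_consensus (irun f w).
Proof.
(* Shifting by [b] encodes the values in [-b, b] as ordinals below 2b + 1, which makes the box a
   finite type. *)
have [w wE wP] := near_consensus_word
  (fun (g : {ffun 'I_N -> 'I_b.*2.+1}) i => (g i)%:Z - b%:Z).
exists w => // f fb.
suff -> : f = (fun i => ([ffun j => inord (absz (f j + b%:Z))] i : 'I_b.*2.+1)%:Z - b%:Z).
  exact: wP.
apply/funext => i; rewrite ffunE inordK; have := fb i; lia.
Qed.

End Graph.

(** * Half-integer parts of the gossip state *)

(** This is what closes the dynamics of [halves]: the floor of x depends on x only through the floor
    of 2x. *)
Lemma floor_double_half (R : realType) (x : R) :
  Num.floor x = (Num.floor (2 * x) %/ 2)%Z.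
Proof.
have /andP[] := floor_itv (2 * x); set m := Num.floor _ => lem ltm.
have [r [r01 em]] : exists r : int, 0 <= r <= 1 /\ m = (m %/ 2)%Z * 2 + r.
  by exists (m %% 2)%Z; lia.
move: (m %/ 2)%Z em => k em; apply: floor_def.
move: r01 lem ltm; rewrite -!(ler_int R) em !intrD !intrM; lra.
Qed.

Lemma qd_itv (R : realType) (x : R) :
  x - 2^-1 <= (qd x)%:~R <= x + 2^-1.
Proof.
have : qd x = qd x by [].
by move/qdP; case: ifP => _; rewrite in_itv /= => /andP[? ?]; apply/andP; split; lra.
Qed.

(** Ties are rounded away from zero, hence symmetrically; bounds on a trajectory thus transfer to
    its negation. *)
Lemma qdN (R : realType) (x : R) : qd (- x) = - qd x.
Proof.
rewrite /qd oppr_ge0; have [x0|x0|->] := ltgtP x 0.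
- by rewrite ceilNfloor opprK; congr Num.floor; lra.
- by rewrite ceilNfloor; congr (- Num.floor _); lra.
- rewrite oppr0 add0r; suff -> : Num.floor (2^-1 : R) = 0 by rewrite oppr0.
  by apply: floor_def; apply/andP; split; lra.
Qed.

(* Hermite's identity is [floor x + floor (x + 1/2) = floor (2 * x)]; [qd x] falls
   short of [floor (x + 1/2)] at negative ties. *)
Lemma qd_floor_le (R : realType) (x : R) :
  qd x + Num.floor x <= Num.floor (2 * x).
Proof.
rewrite floor_ge_int intrD.
have /andP[lef ltf] := floor_itv x; have /andP[_ leq] := qd_itv x.
have [le|lt] := leP (qd x) (Num.floor x).
  by move: le; rewrite -(ler_int R) => le; lra.
have le : qd x <= Num.floor x + 1.
  rewrite -ltzD1 -(ltr_int R) intrD; move: ltf; rewrite intrD; lra.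
have e : qd x = Num.floor x + 1 by lia.
by move: leq; rewrite e intrD; lra.
Qed.

Definition halves (R : realType) (N : nat) (x : 'cV[R]_N) : 'I_N -> int :=
  fun i => Num.floor (2 * x i 0).

Lemma halves_step (R : realType) (N : nat) (p : 'I_N * 'I_N) (x : 'cV[R]_N) h :
  halves (gossip_step p x) h =
    if h == p.1 then Num.floor (x p.1 0) + qd (x p.2 0)
    else if h == p.2 then Num.floor (x p.2 0) + qd (x p.1 0) else halves x h.
Proof.
have e (a : R) (q : int) : Num.floor (2 * (2^-1 * a + 2^-1 * q%:~R)) = Num.floor a + q.
  by rewrite -mulrDr mulVKf ?pnatr_eq0 // floorDrz ?intrKfloor ?intr_int.
by rewrite /halves mxE; case: ifP => _; [|case: ifP => _ //]; rewrite e.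
Qed.

Lemma sum_halves_step (R : realType) (N : nat) (p : 'I_N * 'I_N) (x : 'cV[R]_N) :
  \sum_i halves (gossip_step p x) i <= \sum_i halves x i.
Proof.
have le i : qd (x i 0) + Num.floor (x i 0) <= halves x i := qd_floor_le _.
(* The pair is arbitrary here; if its components coincide, a single entry changes. *)
have [e|ne] := eqVneq p.1 p.2.
  apply: ler_sum => i _; rewrite halves_step -e.
  by case: eqP => // ->; rewrite addrC.
rewrite !(sum_pair _ ne) !halves_step !eqxx eq_sym (negbTE ne).
rewrite (eq_bigr (halves x)) => [|i /andP[]]; last first.
  by move=> /negbTE i1 /negbTE i2; rewrite halves_step i1 i2.
rewrite lerD2r; have := le p.1; have := le p.2; lia.
Qed.

(** Equal sums force equality in [qd_floor_le] at both ends of the pair, so each quantized value is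
    f - floor (f / 2) = ceil (f / 2), where f is the entry of [halves]. *)
Lemma halves_step_eq (R : realType) (N : nat) (p : 'I_N * 'I_N) (x : 'cV[R]_N) :
  \sum_i halves (gossip_step p x) i = \sum_i halves x i ->
  halves (gossip_step p x) = istep p (halves x).
Proof.
have le i : qd (x i 0) + Num.floor (x i 0) <= halves x i := qd_floor_le _.
have fl i : Num.floor (x i 0) = (halves x i %/ 2)%Z := floor_double_half _.
have [e|ne] := eqVneq p.1 p.2; last first.
  rewrite !(sum_pair _ ne) !halves_step !eqxx eq_sym (negbTE ne).
  rewrite (eq_bigr (halves x)) => [|i /andP[]]; last first.
    by move=> /negbTE i1 /negbTE i2; rewrite halves_step i1 i2.
  move=> /addIr e; apply/funext => h; rewrite halves_step /istep /iavg.
  have := le p.1; have := le p.2; move: e; rewrite !fl.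
  by case: ifP => _; [|case: ifP => _ //]; lia.
move=> eqs; have {eqs} /eqP : halves (gossip_step p x) p.1 = halves x p.1.
  move: eqs; rewrite (bigD1 p.1) //= [RHS](bigD1 p.1) //=.
  rewrite (eq_bigr (halves x)) => [/addIr //|i /negbTE i1].
  by rewrite halves_step -e i1.
rewrite halves_step eqxx -e fl => /eqP e1.
apply/funext => h; rewrite halves_step /istep /iavg -e fl.
by case: ifP => [_|-> //]; lia.
Qed.

Lemma gossip_stepN (R : realType) (N : nat) (p : 'I_N * 'I_N) (x : 'cV[R]_N) :
  gossip_step p (- x) = - gossip_step p x.
Proof.
apply/colP => h; rewrite !mxE !qdN !mulrNz.
by case: ifP => _; [|case: ifP => _ //]; rewrite !mulrN -opprD.
Qed.

Lemma gossip_stateN (R : realType) (N : nat) (e : nat -> 'I_N * 'I_N)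
    (x : 'cV[R]_N) t :
  gossip_state e (- x) t = - gossip_state e x t.
Proof. by elim: t => //= t ->; rewrite gossip_stepN. Qed.

Lemma sum_halves_state (R : realType) (N : nat) (e : nat -> 'I_N * 'I_N)
    (x : 'cV[R]_N) t :
  \sum_i halves (gossip_state e x t) i <= \sum_i halves x i.
Proof. by elim: t => //= t; apply/le_trans/sum_halves_step. Qed.

Lemma sum_halves_itv (R : realType) (N : nat) (x : 'cV[R]_N) :
  (\sum_i halves x i)%:~R <= 2 * \sum_i x i 0 <= (\sum_i halves x i + N%:Z)%:~R.
Proof.
have e : (\sum_(i < N) 1 : int) = N%:Z by rewrite big_const_ord iter_addr_0 natz.
rewrite -e -big_split /= mulr_sumr !rmorph_sum /=.
by apply/andP; split; apply: ler_sum => i _; have /andP[? /ltW] := floor_itv (2 * x i 0).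
Qed.

(** * Eventual stationarity of the integer sums *)

Lemma nonincreasing_int_stationary (u : nat -> int) (b : int) :
  (forall t, u t.+1 <= u t) -> (forall t, b <= u t) ->
  exists t0, forall t, (t0 <= t)%N -> u t = u t0.
Proof.
move=> ni ub; have [n] := ubnP `|u 0%N - b|%N.
elim: n u ni ub => // n IH u ni ub un.
have [[t ltt]|nlt] := pselect (exists t, u t < u 0%N).
  have [|//||t0 t0P] := IH (fun k => u (t + k)%N).
  - by move=> k; rewrite addnS.
  - by rewrite addn0; have := ub t; lia.
  exists (t + t0)%N => k tk.
  have le : (t <= k)%N by apply: leq_trans tk; apply: leq_addr.
  by rewrite -[in LHS](subnKC le) t0P // leq_subRL.
have u0 t : u t <= u 0%N by elim: t => // t; apply: le_trans.
exists 0%N => t _; apply/eqP; rewrite eq_le u0 /=.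
by rewrite leNgt; apply/negP => ltt; apply: nlt; exists t.
Qed.

Lemma halves_stationary (R : realType) (N : nat) (e : nat -> 'I_N * 'I_N)
    (x0 : 'cV[R]_N) :
  exists t0, forall t, (t0 <= t)%N ->
    halves (gossip_state e x0 t.+1) = istep (e t) (halves (gossip_state e x0 t)).
Proof.
pose u t := \sum_i halves (gossip_state e x0 t) i.
(* The lower bound adds the upper estimates of [sum_halves_itv] for the state and its negation,
   whose own sum never exceeds its initial value. *)
have [||t0 t0P] := @nonincreasing_int_stationary u
    (- (\sum_i halves (- x0) i + N%:Z + N%:Z)).
- by move=> t; apply: sum_halves_step.
- move=> t; have := sum_halves_state e (- x0) t; rewrite gossip_stateN.
  have /andP[_] := sum_halves_itv (gossip_state e x0 t).
  have /andP[_] := sum_halves_itv (- gossip_state e x0 t).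
  rewrite (eq_bigr (fun i => - gossip_state e x0 t i 0)) => [|i _]; last by rewrite mxE.
  rewrite sumrN mulrN => h1 h2 h3.
  have : 0 <= \sum_i halves (- gossip_state e x0 t) i + N%:Z + (u t + N%:Z).
    by rewrite -(ler_int R) intrD; lra.
  lia.
exists t0 => t tt; apply: halves_step_eq.
exact: (etrans (t0P _ (leqW tt)) (esym (t0P _ tt))).
Qed.

(** * From the integer dynamics back to the real state *)

Lemma near_consensus_dist (R : realType) (N : nat) (x : 'cV[R]_N) :
  near_consensus (halves x) -> forall i j, `|x i 0 - x j 0| <= 1.
Proof.
move=> nc i j; have := nc i j; have := nc j i.
rewrite /halves -!(ler_int R) !intrB.
have /andP[] := floor_itv (2 * x i 0); have /andP[] := floor_itv (2 * x j 0).
by rewrite !intrD ler_norml; lra.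
Qed.

(** With m the entry of [halves x] at i, all entries lie in [m - 1, m + 1], so every 2 x_j lies in
    [m - 1, m + 2). The two sum inequalities carry these bounds over to twice the average of [x0],
    while 2 x_i lies in [m, m + 1). *)
Lemma near_consensus_average (R : realType) (N : nat) (x x0 : 'cV[R]_N) :
  near_consensus (halves x) ->
  \sum_i halves x i <= \sum_i halves x0 i ->
  \sum_i halves (- x) i <= \sum_i halves (- x0) i ->
  `|x - const_mx (average x0)| <= 1.
Proof.
move=> nc lex ltx.
suff H i : `|x i 0 - average x0| <= 1.
  rewrite /Num.norm /= mx_normrE; apply: bigmax_le => // -[i j] _.
  by rewrite !mxE ord1.
have N0 : 0 < N%:R :> R by rewrite ltr0n; case: (N) i => [[]|].
pose m := halves x i.
have sumc (c : int) : \sum_(j < N) c = c * N%:Z.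
  by rewrite sumr_const card_ord -mulr_natr natz.
have lo : (m - 1) * N%:Z <= \sum_j halves x0 j.
  apply: le_trans lex; rewrite -sumc; apply: ler_sum => j _.
  by have := nc i j; rewrite -/m; lia.
have hi : - (m + 2) * N%:Z <= \sum_j halves (- x0) j.
  apply: le_trans ltx; rewrite -sumc; apply: ler_sum => j _.
  rewrite /halves floor_ge_int mxE.
  have := nc j i; rewrite -/m /halves -(ler_int R).
  by have /andP[] := floor_itv (2 * x j 0); rewrite !(intrD, intrB, mulrNz); lra.
have av : \sum_j x0 j 0 = average x0 * N%:R.
  by rewrite /average mulrC mulVKf ?gt_eqF.
move: lo hi; rewrite -!(ler_int R) => lo hi.
have /andP[h1 _] := sum_halves_itv x0; have /andP[h2 _] := sum_halves_itv (- x0).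
move: h2; rewrite (eq_bigr (fun i => - x0 i 0)) => [|j _]; last by rewrite mxE.
rewrite sumrN av => h2; rewrite av in h1.
have {lo h1} : (m - 1)%:~R <= 2 * average x0.
  by rewrite -(ler_pM2r N0) -mulrA; apply: le_trans h1; move: lo; rewrite intrM.
have {hi h2} : (- (m + 2))%:~R <= - (2 * average x0).
  by rewrite -(ler_pM2r N0) mulNr -mulrA -mulrN; apply: le_trans h2; move: hi; rewrite intrM.
have /andP[] := floor_itv (2 * x i 0); rewrite -/(halves x i) -/m.
by rewrite !(intrD, intrB, mulrNz) ler_norml; lra.
Qed.

Lemma halves_irun (R : realType) (N : nat) (e : nat -> 'I_N * 'I_N)
    (x0 : 'cV[R]_N) (t0 k : nat) :
  (forall t, (t0 <= t)%N ->
    halves (gossip_state e x0 t.+1) = istep (e t) (halves (gossip_state e x0 t))) ->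
  halves (gossip_state e x0 (t0 + k)) =
    irun (halves (gossip_state e x0 t0)) [seq e t | t <- iota t0 k].
Proof.
elim: k t0 => [|k IH] t0 st; first by rewrite addn0.
rewrite addnS -addSn IH => [|t lt]; last exact/st/ltnW.
by rewrite st.
Qed.

(** The deterministic half of the proof. The word to be played depends on a bound [b] on the
    trajectory at time [t0], so recurrence is required of every word. *)
Lemma consensus_of_words (R : realType) (N : nat) (adj : rel 'I_N)
    (adj_sym : symmetric adj) (adj_irr : irreflexive adj)
    (adj_connected : forall i j : 'I_N, connect adj i j)
    (e : nat -> 'I_N * 'I_N)
    (words : forall w, {subset w <= edges adj} -> forall t0,
      exists2 t, (t0 <= t)%N & [seq e s | s <- iota t (size w)] = w)
    (x0 : 'cV[R]_N) :
  exists Tcon : nat, forall t : nat, (Tcon <= t)%N ->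
    let x := gossip_state e x0 t in
    (forall i j : 'I_N, `|x i 0 - x j 0| <= 1) /\
    `|x - const_mx (average x0)| <= 1.
Proof.
have [t0 st] := halves_stationary e x0.
pose f t := halves (gossip_state e x0 t); pose b := (\sum_i `|f t0 i|)%N.
have fb t : (t0 <= t)%N -> forall i, `|f t i| <= b%:Z.
  move=> /subnKC <-; elim: (t - t0)%N => [|k IH] i.
    have : (`|f t0 i| <= b)%N by rewrite /b (bigD1 i) //= leq_addr.
    by rewrite addn0; lia.
  rewrite addnS /f st ?leq_addr //.
  suff : - b%:Z <= istep (e (t0 + k)%N) (f (t0 + k)%N) i <= b%:Z by rewrite ler_norml.
  by apply: istep_bounds => j; have := IH j; rewrite ler_norml.
have [w wE wP] := near_consensus_word_bounded adj_sym adj_irr adj_connected b.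
have [t1 t01 ew] := words w wE t0.
exists (t1 + size w)%N => t let1 x.
have nc : near_consensus (halves x).
  have st1 s : (t1 <= s)%N -> _ := fun h => st s (leq_trans t01 h).
  rewrite /x -(subnKC let1) halves_irun; last first.
    by move=> s lts; apply/st1/(leq_trans _ lts)/leq_addr.
  apply: near_consensus_irun; rewrite halves_irun // ew.
  by apply: wP; apply: fb.
split; first exact: near_consensus_dist.
apply: near_consensus_average => //; first exact: sum_halves_state.
by rewrite -gossip_stateN; apply: sum_halves_state.
Qed.

(** * Recurrence of patterns in an independent sequence *)

Section IndependentBlocks.
Context (d : measure_display) (T : measurableType d) (R : realType).
Context (P : probability T R) (D : Type) (X : nat -> T -> D).
Hypotheses (X_rv : forall t, measurable_discrete_valued (X t))
           (X_indep : independent_sequence P X).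

Definition cylinder (a b : nat) (A : nat -> set D) : set T :=
  [set w | forall s, (a <= s < b)%N -> A s (X s w)].

Lemma cylinderE (a b : nat) (A : nat -> set D) :
  cylinder a b A = \bigcap_(t in [set` seq_fset tt (index_iota a b)]) (X t @^-1` A t).
Proof.
have mem s : (s \in seq_fset tt (index_iota a b)) = (a <= s < b)%N.
  by rewrite seq_fsetE mem_index_iota.
by apply/seteqP; split => w H s hs; apply: H; [rewrite -mem | rewrite -mem in hs].
Qed.

Lemma measurable_cylinder (a b : nat) (A : nat -> set D) :
  measurable (cylinder a b A).
Proof.
by rewrite cylinderE; apply: bigcap_measurableType => k _; apply: X_rv.
Qed.

Lemma probability_cylinder (a b : nat) (A : nat -> set D) :
  P (cylinder a b A) = (\prod_(a <= s < b) P (X s @^-1` A s))%E.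
Proof.
rewrite cylinderE X_indep; apply: perm_big.
by rewrite (perm_trans (seq_fset_perm _ _)) // undup_id // iota_uniq.
Qed.

Context (L : nat) (B : nat -> set D) (c : nat -> R).
Hypotheses (c_gt0 : forall i, (i < L)%N -> 0 < c i)
           (X_law : forall t i, (i < L)%N -> P (X t @^-1` B i) = (c i)%:E).

Definition block (t : nat) : set T :=
  [set w | forall i, (i < L)%N -> B i (X (t + i) w)].

Lemma block_cylinder (t : nat) :
  block t = cylinder t (t + L) (fun s => B (s - t)).
Proof.
apply/seteqP; split => w /= H s hs.
  have -> : s = (t + (s - t))%N by lia.
  by rewrite addKn; apply: H; lia.
by have := H (t + s)%N; rewrite addKn; apply; lia.
Qed.

Lemma probability_block_cylinder (t : nat) :
  (\prod_(t <= s < t + L) P (X s @^-1` B (s - t)))%E =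
  (\prod_(i < L) c i)%:E.
Proof.
rewrite -{1}[t]add0n big_addn addKn big_mkord -prodEFin.
by apply: eq_bigr => i _; rewrite addnK X_law.
Qed.

Lemma probability_block (t : nat) : P (block t) = (\prod_(i < L) c i)%:E.
Proof.
by rewrite block_cylinder probability_cylinder probability_block_cylinder.
Qed.

(** Starting times are spaced by [L], so that the tested blocks occupy disjoint time windows. *)
Definition missed (t0 K : nat) : set T :=
  [set w | forall k, (k < K)%N -> ~ block (t0 + k * L) w].

Lemma missed0 t0 : missed t0 0 = setT.
Proof. by apply/seteqP; split. Qed.

Lemma missedS t0 K : missed t0 K.+1 = missed t0 K `\` block (t0 + K * L).
Proof.
apply/seteqP; split => w /= => [H|[H HK] k].
  by split=> [k kK|]; apply: H => //; apply: leqW.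
by rewrite ltnS leq_eqVlt => /predU1P[->|/H].
Qed.

Lemma measurable_block t : measurable (block t).
Proof. by rewrite block_cylinder; apply: measurable_cylinder. Qed.

Lemma measurable_missed t0 K : measurable (missed t0 K).
Proof.
elim: K => [|K IH]; first by rewrite missed0.
by rewrite missedS; apply: measurableD => //; apply: measurable_block.
Qed.

(* The induction on K needs both the cylinder alone and its intersection with
   the K-th block to be cylinders over an interval starting at the K-th block;
   the gap is filled with trivial constraints. *)
Lemma probability_cylinder_missed t0 K n (A : nat -> set D) :
  P (cylinder (t0 + K * L) (t0 + K * L + n) A `&` missed t0 K) =
  (P (cylinder (t0 + K * L) (t0 + K * L + n) A) *
   ((1 - \prod_(i < L) c i) ^+ K)%:E)%E.
Proof.
elim: K n A => [|K IH] n A; first by rewrite missed0 setIT expr0 mule1.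
rewrite mulSnr addnA; set t := (t0 + K * L)%N in IH *.
pose A1 s := if (s < t + L)%N then setT else A s.
pose A2 s := if (s < t + L)%N then B (s - t) else A s.
set C := cylinder _ _ A.
have C1 : C = cylinder t (t + (L + n)) A1.
  apply/seteqP; split => w /= H s hs.
    by rewrite /A1; case: (ltnP s) => // lts; apply: H; lia.
  have := H s; rewrite /A1 (_ : (s < t + L)%N = false); last by lia.
  by apply; lia.
have C2 : C `&` block t = cylinder t (t + (L + n)) A2.
  rewrite block_cylinder; apply/seteqP; split => w /= => [[H1 H2] s hs|H].
    by rewrite /A2; case: (ltnP s) => lts; [apply: H2|apply: H1]; lia.
  split=> s hs; have := H s; rewrite /A2.
    by rewrite (_ : (s < t + L)%N = false); [apply; lia | lia].
  by rewrite (_ : (s < t + L)%N); [apply; lia | lia].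
have PC2 : P (cylinder t (t + (L + n)) A2) = ((\prod_(i < L) c i)%:E * P C)%E.
  rewrite !probability_cylinder addnA.
  rewrite (@big_cat_nat _ _ _ (t + L)) ?leq_addr //=.
  rewrite -(probability_block_cylinder t); congr (_ * _)%E.
    apply: eq_big_nat => s /andP[_ lts]; by rewrite /A2 lts.
  by apply: eq_big_nat => s /andP[les _]; rewrite /A2 ltnNge les.
have mC : measurable C by exact: measurable_cylinder.
have mM := measurable_missed t0 K; have mB := measurable_block t.
have -> : C `&` missed t0 K.+1 = (C `&` missed t0 K) `\` block t.
  by rewrite missedS setDE setIA -setDE.
rewrite measureD //; last 2 first.
- exact: measurableI.
- exact: (le_lt_trans (probability_le1 P (measurableI _ _ mC mM)) (ltry _)).
rewrite setIAC C2 [in X in (X - _)%E]C1.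
(* Both the cylinder and its part inside the block factor through [missed t0 K]; subtracting them
   yields one more factor 1 - \prod c i. *)
have E1 := IH (L + n)%N A1; have E2 := IH (L + n)%N A2.
rewrite [X in (X - _)%E]E1 [X in (_ - X)%E]E2 PC2 -C1.
have -> : P C = (fine (P C))%:E by rewrite fineK // fin_num_measure.
by rewrite -!EFinM -EFinB; congr EFin; rewrite exprS; ring.
Qed.

Lemma block_recurrent (t0 : nat) :
  {ae P, forall w, exists2 t, (t0 <= t)%N & block t w}.
Proof.
set z := 1 - \prod_(i < L) c i.
have z1 : `|z| < 1.
  have c0 : 0 < \prod_(i < L) c i by apply: prodr_gt0 => i _; apply: c_gt0.
  have c1 : \prod_(i < L) c i <= 1.
    by rewrite -lee_fin -(probability_block t0) probability_le1 //; apply: measurable_block.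
  by rewrite ltr_norml /z; lra.
(* A cylinder of length 0 is the whole space. *)
have PM K : P (missed t0 K) = (z ^+ K)%:E.
  have := probability_cylinder_missed t0 K 0 (fun=> setT).
  have -> : cylinder (t0 + K * L) (t0 + K * L + 0) (fun=> setT) = setT.
    by apply/seteqP; split.
  by rewrite setTI probability_setT mul1e.
pose M := \bigcap_K missed t0 K.
have mM : measurable M by apply: bigcap_measurableType => k _; exact: measurable_missed.
have PM0 : P M = 0.
  have fM : P M = (fine (P M))%:E by rewrite fineK // fin_num_measure.
  apply/eqP; rewrite eq_le measure_ge0 andbT fM lee_fin.
  have /cvg_lim <- := cvg_expr z1; last exact: Rhausdorff.
  apply: limr_ge; first by apply/cvg_ex; exists 0; exact: cvg_expr.
  apply: nearW => K; rewrite -lee_fin -fM -PM.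
  by apply: le_measure; rewrite ?inE //; [exact: measurable_missed | exact: bigcap_inf].
exists M; split => // w /= Hw K _ k kK bk; apply: Hw.
by exists (t0 + k * L)%N; first exact: leq_addr.
Qed.

End IndependentBlocks.

(** * Almost sure consensus *)

Theorem theorem5p1 (R : realType) (N : nat) (adj : rel 'I_N)
    (adj_sym : symmetric adj) (adj_irr : irreflexive adj)
    (adj_connected : forall i j : 'I_N, connect adj i j)
    (W : 'I_N * 'I_N -> R)
    (W_gt0 : forall p, p \in edges adj -> 0 < W p)
    (W_sum1 : \sum_(p in edges adj) W p = 1)
    (d : measure_display) (T : measurableType d) (P : probability T R)
    (edge : nat -> T -> 'I_N * 'I_N)
    (edge_rv : forall t, measurable_discrete_valued (edge t))
    (edge_law : forall t p, p \in edges adj ->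
       P (edge t @^-1` [set p]) = (W p)%:E)
    (edge_indep : independent_sequence P edge)
    (x0 : 'cV[R]_N) :
  {ae P, forall w, exists Tcon : nat, forall t : nat, (Tcon <= t)%N ->
    let x := gossip_state (edge^~ w) x0 t in
    (forall i j : 'I_N, `|x i 0 - x j 0| <= 1) /\
    `|x - const_mx (average x0)| <= 2}.
Proof.
(* Weights with sum 1 need at least one edge; [p0] serves as the default of [nth]. *)
have [p0 p0E] : exists p0, p0 \in edges adj.
  apply/existsP; apply: contra_neqT (oner_neq0 R) => /existsPn nE.
  by rewrite -W_sum1 big_pred0 // => p; apply/negbTE.
(* The word needed depends on the sample point, so all words must recur on one almost sure event.
   They are countable: [word] enumerates them, with the empty word for invalid codes. *)
pose word n : seq ('I_N * 'I_N) := odflt [::] (choice.unpickle n).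
have words : {ae P, forall w, forall n t0 : nat,
    {subset word n <= edges adj} -> exists2 t, (t0 <= t)%N &
      [seq edge k w | k <- iota t (size (word n))] = word n}.
  apply: ae_foralln => n; apply: ae_foralln => t0; set s := word n.
  have [sE|nsE] := pselect {subset s <= edges adj}; last first.
    by apply: aeW => w sE; case: nsE.
  have law t i : (i < size s)%N ->
      P (edge t @^-1` [set nth p0 s i]) = (W (nth p0 s i))%:E.
    by move=> si; apply/edge_law/sE/mem_nth.
  have pos i : (i < size s)%N -> 0 < W (nth p0 s i).
    by move=> si; apply/W_gt0/sE/mem_nth.
  have := block_recurrent edge_rv edge_indep pos law t0.
  apply: filterS => w [t tt0 bt] _; exists t => //.
  apply: (@eq_from_nth _ p0); rewrite size_map size_iota // => i si.
  by rewrite (nth_map 0%N) ?size_iota // nth_iota // bt.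
apply: filterS words => w words.
have [|Tcon TconP] := @consensus_of_words R N adj adj_sym adj_irr adj_connected
    (edge^~ w) _ x0.
  move=> s sE t0; have := words (choice.pickle s) t0.
  by rewrite /word choice.pickleK /=; apply.
exists Tcon => t /TconP[dist avg]; split=> //.
by apply: le_trans avg _; rewrite ler1n.
Qed.
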